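(* Let $\emptyset\neq\Delta\subseteq\mathbb{C}$, let $\mathcal{L}=(l_1,\ldots,l_n)$ be a sequence of positive integers with $N=\sum_{i=1}^n l_i$, let $\mathcal{A}\in\{0,*,?\}^{N\times N}$ be a pattern matrix, let $f^{\mathcal{L}}_{\Delta}$ be a $\Delta$-characteristic vector, and let $G_{\mathcal{N}}^{\Delta}=(V_{\mathcal{N}},E_{\mathcal{N}})$ be the associated $\Delta$-network graph, with zero forcing number $\mathcal{Z}(G_{\mathcal{N}}^{\Delta})$. Then $\Psi_{\Delta}(A)\leq\mathcal{Z}(G_{\mathcal{N}}^{\Delta})$ for all $A\in\mathcal{S}(f^{\mathcal{L}}_{\Delta},\mathcal{A})$.
   Context: Pattern matrices. A pattern matrix has entries in the set of symbols $\{0,*,?\}$. For a $q\times p$ pattern matrix $\mathcal{M}$, its pattern class $\mathcal{P}(\mathcal{M})$ is the set of all $M\in\mathbb{R}^{q\times p}$ with $M(i,j)=0$ whenever $\mathcal{M}(i,j)=0$ and $M(i,j)\neq 0$ whenever $\mathcal{M}(i,j)=*$ (entries with symbol $?$ are arbitrary reals). $\mathcal{M}$ has full row rank if every $M\in\mathcal{P}(\mathcal{M})$ has full row rank. Blocks. Given $\mathcal{L}=(l_1,\ldots,l_n)$ and $N=\sum_i l_i$, an $N\times N$ matrix $A$ (or pattern matrix $\mathcal{A}$) is partitioned into blocks $A_{ij}$ (resp. $\mathcal{A}_{ij}$) of size $l_i\times l_j$, $1\le i,j\le n$. Node $i\in\{1,\ldots,n\}$ has vertex set $V_i=\{i^1,\ldots,i^{l_i}\}$,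 identified with the indices of the $i$-th block among $\{1,\ldots,N\}$. For $Z\subseteq\{1,\ldots,n\}$, $\mathrm{Ver}(Z)=\bigcup_{i\in Z}V_i$. $\Delta$-characteristic vector and $\Delta$-specified pattern class. $\Lambda(\cdot)$ denotes the spectrum. A $\Delta$-characteristic vector is a vector $f^{\mathcal{L}}_{\Delta}\in\{0,*,?\}^n$, with $f^{\mathcal{L}}_{\Delta}\in\{*,?\}^n$ if $|\Delta|>1$; it encodes available information on $\Lambda(A_{kk})\cap\Delta$. It is either given directly, or obtained from a given set $\mathcal{S}^*$ of system matrices by: $f^{\mathcal{L}}_{\Delta}(k)=*$ if $\Lambda(A_{kk})\cap\Delta=\emptyset$ for all $A\in\mathcal{S}^*$; $f^{\mathcal{L}}_{\Delta}(k)=0$ if $\Delta=\{\mu\}$ and $A_{kk}=\mu I_{l_k}$ for all $A\in\mathcal{S}^*$; $f^{\mathcal{L}}_{\Delta}(k)=?$ otherwise. The $\Delta$-specified pattern class $\mathcal{S}(f^{\mathcal{L}}_{\Delta},\mathcal{A})$ is the set of all $A\in\mathcal{P}(\mathcal{A})$ such that, for each $k$, $\Lambda(A_{kk})\cap\Delta=\emptyset$ if $f^{\mathcal{L}}_{\Delta}(k)=*$, and $A_{kk}=\mu I_{l_k}$ if $\Delta=\{\mu\}$ and $f^{\mathcal{L}}_{\Delta}(k)=0$. Maximum geometric multiplicity. For $\lambda\in\Lambda(A)$, the geometric multiplicity is $\psi_A(\lambda)=\dim_{\mathbb{C}}\{\nu\in\mathbb{C}^N\mid \nu^TA=\lambda\nu^T\}$.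 $\Psi_{\Delta}(A)=\max\{\psi_A(\lambda)\mid\lambda\in\Lambda(A)\cap\Delta\}$, taken to be $0$ if $\Lambda(A)\cap\Delta=\emptyset$. $\Delta$-network graph. $G_{\mathcal{N}}^{\Delta}=(V_{\mathcal{N}},E_{\mathcal{N}})$ is the directed graph (self-loops allowed) with $V_{\mathcal{N}}=\{1,\ldots,n\}$ and $E_{\mathcal{N}}=E^*_{\mathcal{N}}\cup E^?_{\mathcal{N}}$ (disjoint), where: the self-loop $(i,i)$ is absent if $f^{\mathcal{L}}_{\Delta}(i)=0$, lies in $E^*_{\mathcal{N}}$ if $f^{\mathcal{L}}_{\Delta}(i)=*$, and lies in $E^?_{\mathcal{N}}$ if $f^{\mathcal{L}}_{\Delta}(i)=?$; for $i\neq j$, $(j,i)\notin E_{\mathcal{N}}$ if $\mathcal{A}_{ij}=0$, $(j,i)\in E^*_{\mathcal{N}}$ if $\mathcal{A}_{ij}$ has full row rank, and $(j,i)\in E^?_{\mathcal{N}}$ otherwise. If $(v,u)\in E_{\mathcal{N}}$, $u$ is an out-neighbor of $v$ (a node with a self-loop is an out-neighbor of itself). Coloring and zero forcing sets. Start with the nodes of a set $Z$ black and all others white. Coloring rule: a white node $u$ is colored black if there is a node $v$ (black or white, possibly $v=u$) such that $u$ is the only white out-neighbor of $v$ and $(v,u)\in E^*_{\mathcal{N}}$. Apply the rule repeatedly until no further change is possible; the final set of black nodes is the derived set $\mathcal{D}(Z)$. $Z$ is a zero forcing set (ZFS) if $\mathcal{D}(Z)=V_{\mathcal{N}}$. The zero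 forcing number is $\mathcal{Z}(G_{\mathcal{N}}^{\Delta})=\min\{|\mathrm{Ver}(Z)| : Z \text{ is a ZFS of } G_{\mathcal{N}}^{\Delta}\}$. *)

(* Defs.v *)
From HB Require Import structures.
From mathcomp Require Import all_boot all_order all_algebra.
From mathcomp Require Import boolp classical_sets cardinality fsbigop reals.
From mathcomp Require Export complex.

Set Implicit Arguments.
Unset Strict Implicit.
Unset Printing Implicit Defensive.

Import Order.TTheory GRing.Theory Num.Theory.

Local Open Scope ring_scope.

(* The three symbols 0, *, ?. *)
Inductive psym := PZero | PStar | PAny.

Definition psym_eqb (a b : psym) : bool :=
  match a, b with
  | PZero, PZero | PStar, PStar | PAny, PAny => true
  | _, _ => false
  end.

Lemma psym_eqP : Equality.axiom psym_eqb.
Proof. by case=> -[]; constructor. Qed.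

HB.instance Definition _ := hasDecEq.Build psym psym_eqP.

Section Patterns.
Local Open Scope classical_set_scope.
Context (R : realType).

Definition pattern_class (q p : nat) (P : 'M[psym]_(q, p)) : set 'M[R]_(q, p) :=
  [set M | forall i j,
     (P i j = PZero -> M i j = 0) /\ (P i j = PStar -> M i j != 0)].

Definition pattern_full_row_rank (q p : nat) (P : 'M[psym]_(q, p)) : Prop :=
  forall M, pattern_class P M -> row_free M.

End Patterns.

Section Spectra.
Local Open Scope classical_set_scope.
Context (R : realType).

Definition to_complex (m n : nat) (A : 'M[R]_(m, n)) : 'M[R[i]]_(m, n) :=
  map_mx (real_complex R) A.

Definition spectrum (N : nat) (A : 'M[R]_N) : set R[i] :=
  [set x | eigenvalue (to_complex A) x].

(* MathComp eigenspaces are left eigenspaces: the row space of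
   [eigenspace B x] is the set of row vectors v with v *m B = x *: v. *)
Definition geom_mult (N : nat) (A : 'M[R]_N) (x : R[i]) : nat :=
  \rank (eigenspace (to_complex A) x).

(* The index set is finite by [finite_spectrum], so this is a genuine maximum;
   it is 0 when the index set is empty. *)
Definition max_geom_mult (Delta : set R[i]) (N : nat) (A : 'M[R]_N) : nat :=
  \big[maxn/0%N]_(x \in spectrum A `&` Delta) geom_mult A x.

Lemma finite_spectrum (N : nat) (A : 'M[R]_N) : finite_set (spectrum A).
Proof.
have [r Dr] := closed_field_poly_normal (char_poly (to_complex A)).
apply: (@sub_finite_set _ _ [set` r]); last exact: finite_seq.
move=> x /=; rewrite /spectrum /= eigenvalue_root_char Dr.
by rewrite (monicP (char_poly_monic _)) scale1r root_prod_XsubC.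
Qed.

End Spectra.

Section ZeroForcing.
(* [Es] is the set E* of strong arcs and [E] the set of all arcs; [E v u]
   means that u is an out-neighbor of v. *)
Context (V : finType) (E Es : rel V).
Implicit Types (B Z : {set V}) (u v : V).

Definition out_neighbors v : {set V} := [set u | E v u].

Definition colorable B u : bool :=
  (u \notin B) && [exists v, (out_neighbors v :\: B == [set u]) && Es v u].

Definition color_step B : {set V} := B :|: [set u | colorable B u].

(* A node that can be colored stays colorable until it is colored, so that all
   colorable nodes may be colored simultaneously; the process is then
   stationary after at most #|V| rounds. See [derived_stable] and
   [coloring_run_derived]. *)
Definition derived_set Z : {set V} := iter #|V| color_step Z.

Definition zfs Z : bool := derived_set Z == [set: V].

(* Node-by-node application of the coloring rule. *)
Inductive coloring_run Z : {set V} -> Prop :=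
| coloring_run0 : coloring_run Z Z
| coloring_runS B u :
    coloring_run Z B -> colorable B u -> coloring_run Z (u |: B).

Lemma colorableS B B' u :
  B \subset B' -> colorable B u -> u \notin B' -> colorable B' u.
Proof.
move=> sBB' /andP[_ /existsP[v /andP[/eqP Dv Esvu]]] uB'.
rewrite /colorable uB'; apply/existsP; exists v; rewrite Esvu andbT.
apply/eqP/setP=> w; have /setP/(_ w) := Dv; rewrite !inE.
case: (eqVneq w u) => [->|_]; first by rewrite uB' => /andP[].
case wB: (w \in B) => //=; first by rewrite (fintype.subsetP sBB').
by move->; rewrite andbF.
Qed.

Lemma color_step_iter_sub k Z : Z \subset iter k color_step Z.
Proof.
elim: k => [|k IHk] //=; apply: (fintype.subset_trans IHk); exact: finset.subsetUl.
Qed.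

Lemma derived_stable Z u : ~~ colorable (derived_set Z) u.
Proof.
have fixed B : (forall u, ~~ colorable B u) -> color_step B = B.
  move=> sB; apply/setP=> w; rewrite !inE (negPf (sB w)).
  by rewrite orbF.
suff grow k : (k <= #|iter k color_step Z|)%N \/
    (forall u, ~~ colorable (iter k color_step Z) u).
  have [leVD|//] := grow #|V|.
  rewrite /colorable; suff ->: derived_set Z = [set: V] by rewrite inE.
  by apply/eqP; rewrite eqEcard finset.subsetT cardsT.
elim: k => [|k IHk] /=; first by left.
case: IHk => [lek|sB]; last by right; rewrite fixed.
set B := iter k color_step Z in lek *.
have [sB|/forallPn[w /negPn cw]] := boolP [forall w, ~~ colorable B w].
  by right; rewrite fixed => // w; apply: (forallP sB).
left; apply: (leq_ltn_trans lek); apply: proper_card.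
apply/properP; split; first exact: finset.subsetUl.
by exists w; [rewrite !inE cw orbT | case/andP: cw].
Qed.

Lemma coloring_run_derived Z D :
  coloring_run Z D -> (forall u, ~~ colorable D u) -> D = derived_set Z.
Proof.
move=> runD stD; apply/eqP; rewrite finset.eqEsubset; apply/andP; split.
  elim: runD => [|B u _ sBD cu]; first exact: color_step_iter_sub.
  rewrite finset.subUset sBD andbT finset.sub1set; apply/negPn/negP => uD.
  by have := derived_stable Z u; rewrite (colorableS sBD cu uD).
have sZD : Z \subset D.
  elim: runD {stD} => // B u _ sZB _.
  exact: fintype.subset_trans sZB (finset.subsetUr _ _).
rewrite /derived_set; elim: #|V| => [|k IHk] //=.
rewrite finset.subUset IHk; apply/fintype.subsetP=> w; rewrite inE => cw.
by apply/negPn/negP => wD; have := stD w; rewrite (colorableS IHk cw wD).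
Qed.

Lemma zfs_setT : zfs [set: V].
Proof. by rewrite /zfs finset.eqEsubset finset.subsetT color_step_iter_sub. Qed.

End ZeroForcing.

Section Network.
Local Open Scope classical_set_scope.
Context (R : realType) (n : nat) (l : 'I_n -> nat).
Implicit Types (Delta : set R[i]) (f : 'I_n -> psym).

Local Notation N := (\sum_i l i)%N.

(* The condition reads: if Delta has more than one element, no entry is 0. *)
Definition characteristic_vector Delta f : Prop :=
  (exists x y, [/\ Delta x, Delta y & x <> y]) -> forall k, f k <> PZero.

(* [submxblock A i j], of size l i x l j, is the (i, j) block of A. *)
Definition specified_class Delta f (P : 'M[psym]_N) : set 'M[R]_N :=
  [set A | pattern_class P A /\ forall k : 'I_n,
     (f k = PStar -> spectrum (submxblock A k k) `&` Delta = set0) /\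
     (forall mu : R[i], Delta = [set mu] -> f k = PZero ->
        to_complex (submxblock A k k) = mu%:M)].

(* [network_arc f P j i] describes the pair (j, i): PZero when it is not an
   arc, PStar when it is in E*, PAny when it is in E?. Full row rank refers to
   the real pattern class. *)
Definition network_arc f (P : 'M[psym]_N) (j i : 'I_n) : psym :=
  if i == j then f i
  else if submxblock P i j == const_mx PZero then PZero
  else if `[< pattern_full_row_rank R (submxblock P i j) >] then PStar
  else PAny.

Definition network_edge f (P : 'M[psym]_N) : rel 'I_n :=
  fun j i => network_arc f P j i != PZero.

Definition network_star_edge f (P : 'M[psym]_N) : rel 'I_n :=
  fun j i => network_arc f P j i == PStar.

(* [tagnat.sig1 s] is the block containing the global index s. *)
Definition Ver (Z : {set 'I_n}) : {set 'I_N} :=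
  [set s | tagnat.sig1 s \in Z]%SET.

Definition network_zfs f (P : 'M[psym]_N) (Z : {set 'I_n}) : bool :=
  zfs (network_edge f P) (network_star_edge f P) Z.

(* The minimum exists because the full vertex set is a zero forcing set
   ([zfs_setT]). *)
Definition zero_forcing_number f (P : 'M[psym]_N) : nat :=
  #|Ver [arg min_(Z < [set: 'I_n]%SET | network_zfs f P Z) #|Ver Z|]%N|.

End Network.

(* Main.v *)
(** For an eigenvalue [x] in [Delta], put [C = A - x I].  If [v C = 0], then
    column block [w] of this equation reads [sum_i v_i C_iw = 0], where only
    out-neighbors [i] of [w] contribute.  When [u] is the only out-neighbor
    [i] of [w] with [v_i] not yet known to vanish, and [C_uw] has independent
    rows, also [v_u = 0].  So a left kernel vector of [C] vanishing on a zero
    forcing set [Z] is 0, and restriction to the coordinates in [Ver Z] is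
    injective on the left kernel of [C], i.e. on the eigenspace. *)

Require Import Defs.
From mathcomp Require Import all_boot all_order all_algebra.
From mathcomp Require Import boolp classical_sets reals.
From mathcomp Require Import cardinality fsbigop.

Local Open Scope classical_set_scope.
Local Open Scope ring_scope.

Import GRing.Theory.

(** By [colorableS], a node colorable from a subset of [D] is in [D] or still colorable from [D].
    This replaces an induction along a coloring run. *)
Lemma derived_set_sub (V : finType) (E Es : rel V) (Z D : {set V}) :
  Z \subset D -> (forall u, ~~ colorable E Es D u) ->
  derived_set E Es Z \subset D.
Proof.
move=> sZD stD; rewrite /derived_set; elim: #|V| => [//|k IHk] /=.
rewrite finset.subUset IHk; apply/fintype.subsetP => u; rewrite inE => cu.
by apply/negPn/negP => /(colorableS IHk cu); rewrite (negPf (stD u)).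
Qed.

Lemma fsbigmax_leq (T : choiceType) (S : set T) (g : T -> nat) (m : nat) :
  finite_set S -> (forall x, S x -> g x <= m)%N ->
  (\big[maxn/0%N]_(x \in S) g x <= m)%N.
Proof.
move=> finS leg; rewrite fsbig_finite //; apply/bigmax_leqP_seq => x + _.
by rewrite in_fset_set // => /set_mem/leg.
Qed.

Lemma mxrank_leq_coords (F : fieldType) (m n : nat) (A : 'M[F]_(m, n))
    (S : {set 'I_n}) :
  (forall v : 'rV_n, (v <= A)%MS -> (forall s, s \in S -> v 0 s = 0) -> v = 0) ->
  (\rank A <= #|S|)%N.
Proof.
(* Right multiplication by [G] keeps the coordinates in [S]. Being injective on the row space of
   [A], it preserves the rank, and [A *m G] has [#|S|] columns. *)
move=> inj; pose G : 'M[F]_(n, #|S|) := colsub enum_val 1%:M.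
suff /eqP/mxrank_injP <- : (A :&: kermx G)%MS = 0 by exact: rank_leq_col.
apply/eqP/rowV0P => v; rewrite sub_capmx => /andP[vA /sub_kermxP vG].
apply: inj => // s sS.
have /rowP/(_ (enum_rank_in sS s)) := vG.
rewrite !mxE (bigD1 s) //= !mxE enum_rankK_in // eqxx mulr1 big1 ?addr0 //.
by move=> t; rewrite !mxE enum_rankK_in // => /negPf->; rewrite mulr0.
Qed.

Section BlockMatrices.
Context (F : fieldType) (n : nat) (l : 'I_n -> nat).
Local Notation N := (\sum_i l i)%N.

Lemma submxrow_mul (m : nat) (v : 'M[F]_(m, N)) (C : 'M[F]_N) j :
  submxrow (v *m C) j = \sum_i submxrow v i *m submxblock C i j.
Proof.
rewrite -{1}[v]submxrowK -{1}[C]submxblockK mul_mxrow_mxblock.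
exact: mxrowK.
Qed.

Lemma submxblock_scalar (a : F) i j : i != j ->
  submxblock (a%:M : 'M[F]_N) i j = 0.
Proof.
move=> ij; apply/matrixP => s t; rewrite !mxE; case: eqP => // /(congr1 tagnat.sig1).
by rewrite !tagnat.Rank1K => /eqP; rewrite (negPf ij).
Qed.

Lemma submxblock_scalar_diag (a : F) i :
  submxblock (a%:M : 'M[F]_N) i i = a%:M.
Proof.
apply/matrixP => s t; rewrite !mxE; congr (_ *+ (nat_of_bool _)).
by rewrite (inj_eq (@tagnat.rank_inj _ _)) eq_Tagged.
Qed.

Lemma mxrank_kermx_zfs (C : 'M[F]_N) (E Es : rel 'I_n) (Z : {set 'I_n}) :
  (forall i j, ~~ E j i -> submxblock C i j = 0) ->
  (forall i j, Es j i -> row_free (submxblock C i j)) ->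
  zfs E Es Z -> (\rank (kermx C) <= #|Ver l Z|)%N.
Proof.
move=> C0 Cfree /eqP zfsZ; apply: mxrank_leq_coords => v /sub_kermxP vC v0.
(* The blocks on which [v] vanishes: [D] contains [Z], and it remains to see that no node is
   colorable from it. *)
pose D := [set i | submxrow v i == 0]%SET.
suff sTD : [set: 'I_n]%SET \subset D.
  rewrite -[v]submxrowK; apply/rowP => s; rewrite !mxE.
  have /fintype.subsetP/(_ (tagnat.sig1 s) (finset.in_setT _)) := sTD.
  by rewrite inE => /eqP/rowP/(_ (tagnat.sig2 s)); rewrite !mxE.
rewrite -zfsZ; apply: derived_set_sub => [|u].
  apply/fintype.subsetP => i iZ; rewrite inE; apply/eqP/rowP => s.
  by rewrite !mxE; apply: v0; rewrite inE tagnat.Rank1K.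
apply/negP => /andP[uD /existsP[w /andP[/eqP Dw /Cfree Cuw]]].
have := submxrow_mul _ v C w; rewrite vC submxrow0 (bigD1 u) //= big1 => [|i iu].
  rewrite addr0 => /esym/eqP; rewrite mulmx_free_eq0 // => vu.
  by rewrite inE vu in uD.
(* For [i != u], either [C_iw = 0], or [i] is an out-neighbor of [w] other than [u], hence in [D],
   and [v_i = 0]. *)
have [/C0->|Ewi] := boolP (~~ E w i); first by rewrite mulmx0.
have /setP/(_ i) := Dw; rewrite !inE (negPf iu) (negPn Ewi) andbT.
by move=> /negbFE/eqP->; rewrite mul0mx.
Qed.

End BlockMatrices.

Section NetworkBlocks.
Context (R : realType) (Delta : set (complex R)) (n : nat) (l : 'I_n -> nat).
Context (P : 'M[psym]_(\sum_i l i)) (f : 'I_n -> psym).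
Context (A : 'M[R]_(\sum_i l i)) (x : complex R).
Hypotheses (f_char : characteristic_vector Delta f) (Dx : Delta x).
Hypothesis specA : specified_class Delta f P A.

Let C := to_complex A - x%:M.

Lemma submxblock_shift_diag i :
  submxblock C i i = to_complex (submxblock A i i) - x%:M.
Proof.
rewrite submxblockB submxblock_scalar_diag; congr (_ - _).
by apply/matrixP => s t; rewrite !mxE.
Qed.

Lemma submxblock_shift i j : i != j ->
  submxblock C i j = to_complex (submxblock A i j).
Proof.
move=> ij; rewrite submxblockB submxblock_scalar // subr0.
by apply/matrixP => s t; rewrite !mxE.
Qed.

Lemma network_edge_submxblock i j :
  ~~ network_edge R f P j i -> submxblock C i j = 0.
Proof.
case: specA => PA diagA; rewrite negbK /network_arc.
have [<- /eqP fi|ij] := eqVneq i j.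
  (* A second element of [Delta] would forbid [f i = PZero]; so [A_ii = x I]. *)
  have DeltaE : Delta = [set x].
    apply/seteqP; split => [y Dy|y ->] //=; apply: contrapT => yx.
    by apply: (f_char _ i) => //; exists y, x.
  by rewrite submxblock_shift_diag (proj2 (diagA i) x) // subrr.
case: (submxblock P i j =P _) => [P0 _|_]; last by case: ifP.
rewrite submxblock_shift //; apply/matrixP => s t; rewrite !mxE.
have /matrixP/(_ s t) := P0; rewrite !mxE => Pst.
by rewrite (proj1 (PA _ _)) // rmorph0.
Qed.

Lemma network_star_edge_submxblock i j :
  network_star_edge R f P j i -> row_free (submxblock C i j).
Proof.
case: specA => PA diagA; rewrite /network_star_edge /network_arc.
have [<- /eqP fi|ij] := eqVneq i j.
  (* A nonzero left kernel of [A_ii - x I] makes [x] an eigenvalue of [A_ii] lying in [Delta]. *)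
  rewrite submxblock_shift_diag -kermx_eq0; apply/negPn/negP => eigx.
  by have /seteqP[/(_ x) + _] := proj1 (diagA i) fi; apply.
case: (submxblock P i j =P _) => // _; case: asboolP => // free _.
(* Full row rank is assumed over the reals; field extension preserves rank. *)
rewrite submxblock_shift // row_free_map; apply: free => s t.
by rewrite !mxE; apply: PA.
Qed.

End NetworkBlocks.

Theorem proposition2 (R : realType) (Delta : set (complex R)) (n : nat)
    (l : 'I_n -> nat) (P : 'M[psym]_(\sum_i l i)) (f : 'I_n -> psym)
    (Delta_neq0 : Delta !=set0)
    (l_gt0 : forall i, (0 < l i)%N)
    (f_char : characteristic_vector Delta f)
    (A : 'M[R]_(\sum_i l i)) :
  specified_class Delta f P A ->
  (max_geom_mult Delta A <= zero_forcing_number R f P)%N.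
Proof.
move=> specA; apply: fsbigmax_leq => [|x [_ Dx]].
  exact/finite_setIl/finite_spectrum.
rewrite /zero_forcing_number; case: arg_minnP => [|Z zfsZ _].
  exact: zfs_setT.
(* [eigenspace] unfolds to the left kernel of [to_complex A - x%:M]. *)
apply: mxrank_kermx_zfs zfsZ => i j.
  exact: (network_edge_submxblock _ _ _ _ _ _ _ _ f_char Dx specA).
exact: (network_star_edge_submxblock _ _ _ _ _ _ _ _ Dx specA).
Qed.
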